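(* Let $(\mathfrak{H},(\cdot,\cdot)_{\mathfrak{H}})$ and $(\mathfrak{K},(\cdot,\cdot)_{\mathfrak{K}})$ be complex Hilbert spaces, let $T,B:\mathfrak{H}\to\mathfrak{K}$ be closed densely defined linear operators, and let $\lambda\ge 0$. Then the following statements are equivalent: (1) $\mathrm{dom}\,B\subseteq\mathrm{dom}\,T$ and $\|Tf\|_{\mathfrak{K}}^2\le\lambda\,(Tf,Bf)_{\mathfrak{K}}$ for all $f\in\mathrm{dom}\,B$; (2) there exists $X\in\mathbf{B}^+(\mathfrak{K})$ such that $\|X\|\le\lambda$ and $XB\subseteq T$. In this case, $X$ can be selected such that, in addition, $\mathrm{ran}\,X\subseteq\overline{\mathrm{ran}}\,T$.
   Context: Operators are linear and possibly unbounded, with domain $\mathrm{dom}$ and range $\mathrm{ran}$; $\overline{\mathrm{ran}}\,T$ is the closure of $\mathrm{ran}\,T$. $\mathbf{B}^+(\mathfrak{K})$ is the set of bounded everywhere defined nonnegative (selfadjoint) operators on $\mathfrak{K}$. The inclusion $XB\subseteq T$ is inclusion of graphs: $\mathrm{dom}\,B\subseteq\mathrm{dom}\,T$ and $XBf=Tf$ for all $f\in\mathrm{dom}\,B$. An inequality involving $(Tf,Bf)_{\mathfrak{K}}$ includes the claim that the quantities compared are real. *)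

(* Defs.v *)
From HB Require Import structures.
From mathcomp Require Import all_boot all_order all_algebra.
From mathcomp Require Import complex.
From mathcomp Require Import boolp classical_sets reals topology normedtype.

Set Implicit Arguments.
Unset Strict Implicit.
Unset Printing Implicit Defensive.

Import Order.TTheory GRing.Theory Num.Theory.
Import numFieldNormedType.Exports.

Local Open Scope classical_set_scope.
Local Open Scope ring_scope.
Local Open Scope complex_scope.

(* The inner product is linear in its first argument and conjugate-linear in
   its second one. *)
HB.mixin Record CompleteNormedModule_isHilbert (R : realType) H
    & CompleteNormedModule R[i] H := {
  inner : {dot H for (@Num.conj R[i])} ;
  sqr_norm_inner : forall x : H, `|x| ^+ 2 = inner x x
}.

#[short(type="hilbertType")]
HB.structure Definition Hilbert (R : realType) :=
  {H of CompleteNormedModule_isHilbert R H & CompleteNormedModule R[i] H}.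

Notation "'[ x , y ]" := (inner x%R y%R) : ring_scope.

(* The values of opfun outside opdom are irrelevant: every notion below only
   looks at opfun on opdom. *)
Record linop (R : realType) (H K : hilbertType R) := Linop {
  opdom : set H ;
  opfun :> H -> K ;
  opdom0 : opdom 0 ;
  opdomP : forall (a : R[i]) (f g : H),
    opdom f -> opdom g -> opdom (a *: f + g) ;
  opfunP : forall (a : R[i]) (f g : H),
    opdom f -> opdom g -> opfun (a *: f + g) = a *: opfun f + opfun g
}.

Section UnboundedOperators.
Variables (R : realType) (H K : hilbertType R).
Implicit Types T S : linop H K.

Definition opran T : set K := T @` opdom T.

Definition opgraph T : set (H * K) := [set p | opdom T p.1 /\ p.2 = T p.1].

Definition closed_op T := closed (opgraph T).

Definition densely_defined T := dense (opdom T).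

Definition op_subset S T :=
  opdom S `<=` opdom T /\ forall f, opdom S f -> S f = T f.

End UnboundedOperators.

Section EverywhereDefined.
Variables (R : realType) (H K : hilbertType R).
Implicit Types X : {linear K -> K}.

Lemma comp_opfunP X (B : linop H K) (a : R[i]) (f g : H) :
  opdom B f -> opdom B g ->
  X (B (a *: f + g)) = a *: X (B f) + X (B g).
Proof. by move=> Bf Bg; rewrite opfunP // linearP. Qed.

(* Since X is everywhere defined, dom (XB) = dom B. *)
Definition comp_op X (B : linop H K) : linop H K :=
  Linop (opdom0 B) (@opdomP _ _ _ B) (@comp_opfunP X B).

Definition selfadjoint X := forall g h : K, '[X g, h] = '[g, X h].

(* In R[i], 0 <= z means that z is real and nonnegative. *)
Definition nonnegative X := forall g : K, 0 <= '[X g, g].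

(* The class B^+(K). *)
Definition bounded_nonneg X :=
  [/\ bounded_near X (nbhs (0 : K)), selfadjoint X & nonnegative X].

(* Norms of vectors are (real nonnegative) elements of R[i], whence Re. *)
Definition opnorm X : R :=
  sup [set complex.Re `|X g| | g in [set g : K | `|g| <= 1]].

End EverywhereDefined.

(* Main.v *)
Require Import Defs.
From HB Require Import structures.
From mathcomp Require Import all_boot all_order all_algebra.
From mathcomp Require Import complex.
From mathcomp Require Import boolp classical_sets reals topology normedtype.
From mathcomp Require Import ring lra interval_inference.

Set Implicit Arguments.
Unset Strict Implicit.
Unset Printing Implicit Defensive.

Import Order.TTheory GRing.Theory Num.Theory.
Import numFieldNormedType.Exports.

Local Open Scope classical_set_scope.
Local Open Scope ring_scope.
Local Open Scope complex_scope.

(** Only the implication from the quadratic inequality to the existence of X is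
    substantial.  The inequality says that t(f, g) = (T f, B g) is a nonnegative
    hermitian form on dom B (the diagonal is real, so hermitian symmetry
    follows by polarization, [inner_hermitian_of_real_diag]) and that
    |T f|^2 <= lambda t(f, f).  Let E be the Hilbert space completion of dom B
    for t and J : E -> K the operator, of norm at most sqrt lambda, induced by
    T.  Since (B g, J f) = (B g, T f) = t(g, f), the adjoint J^* sends B g to the class
    of g, so that X = J J^* is nonnegative, bounded by lambda, satisfies
    X B g = T g, and has its range in the closure of ran T.

    E is never built.  A vector f of dom B is within sqrt d of J^* h in E
    exactly when |(h, T g) - t(f, g)|^2 <= d t(g, g) for all g ([approx]); such
    f exist for every d > 0 because they are found among the almost maximizers
    of 2 Re (h, T f) - t(f, f) ([approx_exists]).  Then T f converges to X h as
    d tends to 0.  The graph of X is therefore described by [ext_graph], which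
    is shown to be the graph of a linear map ([ext_graph_fun],
    [ext_graph_lin], [ext_graph_total]; completeness of K enters in the last
    one), to contain the pairs (B f, T f) ([ext_graph_ran]), and to satisfy
    (k, h) >= 0 and |k|^2 <= lambda (k, h) ([ext_graph_ge0],
    [ext_graph_sqnorm_le]).

    Conversely, for X nonnegative with norm at most lambda, the Cauchy-Schwarz
    inequality for the form (X g, h) gives |X g|^2 <= lambda (X g, g)
    ([nonneg_sqnorm_le]), which is the quadratic inequality at g = B f.

    Most estimates are made with the real part of the inner product, whose
    values lie in the ordered field R. *)

(** * Elementary inequalities *)

Section RealInequalities.
Variable R : realFieldType.
Implicit Types a b c d e x y : R.

(** The discriminant of a quadratic polynomial without sign change. *)
Lemma sqr_le_of_quad_ge0 a b c :
  0 <= c -> (forall r, 0 <= a + 2 * r * b + r ^+ 2 * c) -> b ^+ 2 <= a * c.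
Proof.
move=> c0 q0; have [c_eq0|c_neq0] := eqVneq c 0.
  suff -> : b = 0 by rewrite c_eq0 mulr0 expr0n.
  apply/eqP/negP => /negP b0; have := q0 (- (a + 1) / (2 * b)).
  rewrite c_eq0 (_ : a + _ + _ = -1) ?ler0N1 //.
  by field.
have := q0 (- b / c).
rewrite (_ : a + _ + _ = (a * c - b ^+ 2) / c); last by field.
by rewrite pmulr_lge0 ?subr_ge0 // invr_gt0 lt_def c_neq0.
Qed.

Lemma ler_double_of_sqr x a b :
  0 <= a -> 0 <= b -> x ^+ 2 <= a * b -> 2 * x <= a + b.
Proof. by move=> a0 b0 xab; have := sqr_ge0 (a - b); nra. Qed.

Lemma ler_of_sqr_scaled x e c :
  0 <= e -> 0 <= c -> x ^+ 2 <= e ^+ 2 * c -> x <= e * (c + 1).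
Proof.
move=> e0 c0 xec; rewrite leNgt; apply/negP => lt_x.
have : (e * (c + 1)) ^+ 2 < x ^+ 2.
  by rewrite ltr_pXn2r ?nnegrE //; nra.
by have := sqr_ge0 e; nra.
Qed.

Lemma ler_of_sqr_self x d : 0 <= d -> 0 <= x -> x ^+ 2 <= d * x -> x <= d.
Proof.
move=> d0 x0 xd; have [->//|xn0] := eqVneq x 0.
by rewrite -(@ler_pM2r _ x) ?lt_def ?xn0 // -expr2.
Qed.

(** An estimate with an arbitrarily small linear error; only e <= 1 is needed,
    which lets the error constant absorb the powers of e. *)
Lemma ler_of_ler_small x y c :
  0 <= c -> (forall e, 0 < e -> e <= 1 -> x <= y + e * c) -> x <= y.
Proof.
move=> c0 xy; apply/ler_addgt0Pr => e e0.
have c1 : 0 < c + 1 by rewrite ltr_wpDl.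
have [le1|lt1] := leP (e / (c + 1)) 1.
  have := xy _ (divr_gt0 e0 c1) le1; move/le_trans; apply.
  by rewrite lerD2l mulrAC ler_pdivrMr // ler_pM2l // lerDl.
have := xy 1 ltr01 (lexx _); move/le_trans; apply.
by move: lt1; rewrite ltr_pdivlMr // mul1r => ?; lra.
Qed.

End RealInequalities.

(** * Real and imaginary parts *)

Lemma ReD (R : rcfType) (z w : R[i]) :
  complex.Re (z + w) = complex.Re z + complex.Re w.
Proof. by case: z w => ? ? []. Qed.

Lemma ReN (R : rcfType) (z : R[i]) : complex.Re (- z) = - complex.Re z.
Proof. by case: z. Qed.

Lemma ReM (R : rcfType) (z w : R[i]) : complex.Re (z * w) =
  complex.Re z * complex.Re w - complex.Im z * complex.Im w.
Proof. by case: z w => ? ? []. Qed.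

Lemma ImD (R : rcfType) (z w : R[i]) :
  complex.Im (z + w) = complex.Im z + complex.Im w.
Proof. by case: z w => ? ? []. Qed.

Lemma ImM (R : rcfType) (z w : R[i]) : complex.Im (z * w) =
  complex.Re z * complex.Im w + complex.Im z * complex.Re w.
Proof. by case: z w => ? ? []. Qed.

Lemma ReJ (R : rcfType) (z : R[i]) : complex.Re z^* = complex.Re z.
Proof. by case: z. Qed.

Lemma ImJ (R : rcfType) (z : R[i]) : complex.Im z^* = - complex.Im z.
Proof. by case: z. Qed.

(** * The real part of the inner product *)

Section RealInnerProduct.
Variables (R : realType) (K : hilbertType R).
Implicit Types (x y z : K) (a : R[i]) (r : R).

(** The real inner product underlying the complex one. *)
Definition rdot x y : R := complex.Re '[x, y].

(** The square of the norm, as an element of R rather than of R[i]. *)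
Definition sqnorm x : R := rdot x x.

Lemma innerC x y : '[x, y] = ('[y, x])^*.
Proof. by rewrite hermC expr0 mul1r. Qed.

Lemma innerZr a x y : '[x, a *: y] = a^* * '[x, y].
Proof. by rewrite linearZr_LR. Qed.

Lemma innerZl a x y : '[a *: x, y] = a * '[x, y].
Proof. by rewrite linearZl_LR. Qed.

Lemma rdotC x y : rdot x y = rdot y x.
Proof. by rewrite /rdot innerC; case: '[y, x]. Qed.

Lemma rdotDl x y z : rdot (x + y) z = rdot x z + rdot y z.
Proof. by rewrite /rdot linearDl ReD. Qed.

Lemma rdotDr x y z : rdot x (y + z) = rdot x y + rdot x z.
Proof. by rewrite rdotC rdotDl !(rdotC x). Qed.

Lemma rdotZl r x y : rdot (r%:C *: x) y = r * rdot x y.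
Proof.
by rewrite /rdot innerZl ReM /= mul0r subr0.
Qed.

Lemma rdotZr r x y : rdot x (r%:C *: y) = r * rdot x y.
Proof. by rewrite rdotC rdotZl rdotC. Qed.

Lemma rdotNl x y : rdot (- x) y = - rdot x y.
Proof. by rewrite /rdot linearNl ReN. Qed.

Lemma rdotNr x y : rdot x (- y) = - rdot x y.
Proof. by rewrite rdotC rdotNl rdotC. Qed.

Lemma rdotBl x y z : rdot (x - y) z = rdot x z - rdot y z.
Proof. by rewrite rdotDl rdotNl. Qed.

Lemma rdot_adj a x y : rdot (a *: x) y = rdot x (a^* *: y).
Proof. rewrite /rdot innerZl innerZr. by rewrite conjCK. Qed.

Lemma Im_inner x y : complex.Im '[x, y] = rdot x ('i *: y).
Proof.
rewrite /rdot innerZr; case: '[x, y] => a b /=.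
by rewrite mul0r mulN1r sub0r opprK.
Qed.

Lemma inner_norm_real x : '[x, x] = (sqnorm x)%:C.
Proof.
rewrite /sqnorm /rdot RRe_real // -sqr_norm_inner.
by rewrite ger0_real // exprn_ge0.
Qed.

Lemma sqnorm_ge0 x : 0 <= sqnorm x.
Proof. by rewrite -ler0c -inner_norm_real -sqr_norm_inner exprn_ge0. Qed.

Lemma sqr_Re_norm x : complex.Re `|x| ^+ 2 = sqnorm x.
Proof.
apply: complexI; rewrite -inner_norm_real -sqr_norm_inner rmorphXn /=.
by rewrite RRe_real // normr_real.
Qed.

Lemma normE x : `|x| = (Num.sqrt (sqnorm x))%:C.
Proof.
rewrite -sqr_Re_norm sqrtr_sqr ger0_norm ?RRe_real ?normr_real //.
by rewrite -ler0c RRe_real ?normr_real.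
Qed.

Lemma sqnorm_eq0 x : sqnorm x = 0 -> x = 0.
Proof. by move=> x0; apply/normr0_eq0; rewrite normE x0 sqrtr0. Qed.

Lemma norm_le r x : 0 <= r -> (`|x| <= r%:C) = (sqnorm x <= r ^+ 2).
Proof.
move=> r0; rewrite normE lecR -(@ler_pXn2r _ 2) ?nnegrE ?sqrtr_ge0 //.
by rewrite sqr_sqrtr ?sqnorm_ge0.
Qed.

Lemma norm_lt r x : 0 <= r -> (`|x| < r%:C) = (sqnorm x < r ^+ 2).
Proof.
move=> r0; rewrite normE ltcR -(@ltr_pXn2r _ 2) ?nnegrE ?sqrtr_ge0 //.
by rewrite sqr_sqrtr ?sqnorm_ge0.
Qed.

Lemma rdotZZ a x y : rdot (a *: x) (a *: y) =
  (complex.Re a ^+ 2 + complex.Im a ^+ 2) * rdot x y.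
Proof.
rewrite /rdot innerZl innerZr mulrA -normCK -add_Re2_Im2.
by rewrite ReM /= mul0r subr0.
Qed.

Lemma sqnormZ a x :
  sqnorm (a *: x) = (complex.Re a ^+ 2 + complex.Im a ^+ 2) * sqnorm x.
Proof. exact: rdotZZ. Qed.

Lemma sqnormZr r x : sqnorm (r%:C *: x) = r ^+ 2 * sqnorm x.
Proof. by rewrite sqnormZ /= expr0n addr0. Qed.

Lemma sqnormD x y : sqnorm (x + y) = sqnorm x + 2 * rdot x y + sqnorm y.
Proof. by rewrite /sqnorm rdotDl !rdotDr (rdotC y x); ring. Qed.

Lemma sqnormN x : sqnorm (- x) = sqnorm x.
Proof. by rewrite /sqnorm rdotNl rdotNr opprK. Qed.

Lemma sqnormBC x y : sqnorm (x - y) = sqnorm (y - x).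
Proof. by rewrite -sqnormN opprB. Qed.

Lemma sqnormD_le x y : sqnorm (x + y) <= 2 * (sqnorm x + sqnorm y).
Proof.
have := sqnorm_ge0 (x - y); rewrite !sqnormD rdotNr sqnormN => ?; lra.
Qed.

Lemma rdot_CauchySchwarz x y : rdot x y ^+ 2 <= sqnorm x * sqnorm y.
Proof.
apply: sqr_le_of_quad_ge0 (sqnorm_ge0 y) _ => r.
by have := sqnorm_ge0 (x + r%:C *: y); rewrite sqnormD sqnormZr rdotZr mulrA.
Qed.

End RealInnerProduct.

(** Polarization: a sesquilinear form (S f, U g) which is real on the diagonal
    is hermitian.  It is used both for t(f, g) = (T f, B g) on dom B and for
    (X g, h) on the whole space. *)
Lemma inner_hermitian_of_real_diag (R : realType) (K : hilbertType R)
    (V : lmodType R[i]) (D : set V) (S U : V -> K) :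
  (forall a f g, D f -> D g -> D (a *: f + g)) ->
  (forall a f g, D f -> D g -> S (a *: f + g) = a *: S f + S g) ->
  (forall a f g, D f -> D g -> U (a *: f + g) = a *: U f + U g) ->
  (forall f, D f -> complex.Im '[S f, U f] = 0) ->
  forall f g, D f -> D g -> '[S f, U g] = ('[S g, U f])^*.
Proof.
move=> DP SP UP SU0 f g Df Dg.
have key a : complex.Im (a * '[S f, U g] + a^* * '[S g, U f]) = 0.
  have := SU0 _ (DP a _ _ Df Dg).
  rewrite SP // UP // linearDl !linearDr /= !innerZl !innerZr.
  rewrite !(ImD, ImM, ReM, ReJ, ImJ) (SU0 _ Df) (SU0 _ Dg) => e; lra.
have := key 1; have := key 'i; rewrite !(ImD, ImM, ReJ, ImJ) /= => k1 k2.
by apply/eqP; rewrite eq_complex ReJ ImJ; apply/andP; split; apply/eqP; lra.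
Qed.

(** * Bounded nonnegative operators *)

Section BoundedNonneg.
Variables (R : realType) (K : hilbertType R) (X : {linear K -> K}).

Lemma Re_norm_ge0 (x : K) : 0 <= complex.Re `|x|.
Proof. by rewrite normE /= sqrtr_ge0. Qed.

Lemma opnorm_le (c : R) : 0 <= c ->
  (forall g, sqnorm (X g) <= c ^+ 2 * sqnorm g) -> opnorm X <= c.
Proof.
move=> c0 Xc; apply: ge_sup => [|_ [g /= g1 <-]].
  by exists (complex.Re `|X 0|), 0 => //=; rewrite normr0 ler01.
have le_c : `|X g| <= c%:C.
  rewrite norm_le // (le_trans (Xc g)) // ler_piMr ?sqr_ge0 //.
  by move: g1; rewrite (_ : 1 = (1 : R)%:C) // norm_le // expr1n.
by rewrite -lecR RRe_real ?normr_real.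
Qed.

Lemma opnorm_ub h : bounded_near X (nbhs (0 : K)) -> `|h| <= 1 ->
  complex.Re `|X h| <= opnorm X.
Proof.
move=> /linear_boundedP /pinfty_ex_gt0 [M M0 XM] h1.
apply: ub_le_sup; last by exists h.
exists (complex.Re M) => _ [g /= g1 <-].
have /(le_trans (XM g)) : M * `|g| <= M by rewrite ler_piMr // ltW.
by rewrite lecE => /andP[].
Qed.

Lemma opnorm_ge0 : bounded_near X (nbhs (0 : K)) -> 0 <= opnorm X.
Proof.
move=> Xb; apply: le_trans (Re_norm_ge0 (X 0)) (opnorm_ub Xb _).
by rewrite normr0 ler01.
Qed.

Lemma sqnorm_le_opnorm g : bounded_near X (nbhs (0 : K)) ->
  sqnorm (X g) <= opnorm X ^+ 2 * sqnorm g.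
Proof.
move=> Xb.
have [->|g0] := eqVneq g 0.
  by rewrite linear0 /sqnorm /rdot linear0l mulr0.
set r := complex.Re `|g|.
have rE : `|g| = r%:C by rewrite RRe_real ?normr_real.
have r0 : 0 < r by rewrite -ltcR -rE normr_gt0.
have norm1 : `|r^-1%:C *: g| <= 1.
  rewrite (_ : 1 = (1 : R)%:C) // norm_le // sqnormZr -sqr_Re_norm -/r.
  by rewrite -exprMn mulVf ?gt_eqF.
have le_op := opnorm_ub Xb norm1.
have := Re_norm_ge0 (X (r^-1%:C *: g)) => ge0.
have : sqnorm (X (r^-1%:C *: g)) <= opnorm X ^+ 2.
  by rewrite -sqr_Re_norm ler_pXn2r ?nnegrE // (le_trans ge0).
rewrite linearZ /= sqnormZr exprVn -(sqr_Re_norm g) -/r mulrC.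
by rewrite ler_pdivrMr // exprn_gt0.
Qed.

Lemma bounded_near_of_sqnorm_le (c : R) : 0 <= c ->
  (forall g, sqnorm (X g) <= c ^+ 2 * sqnorm g) ->
  bounded_near X (nbhs (0 : K)).
Proof.
move=> c0 Xc; apply/linear_boundedP; near=> M => x.
have -> : `|x| = (complex.Re `|x|)%:C by rewrite RRe_real ?normr_real.
have cM : c%:C <= M by near: M; apply: nbhs_pinfty_ge; rewrite complex_real.
apply: le_trans (_ : (c * complex.Re `|x|)%:C <= _).
  by rewrite norm_le ?mulr_ge0 ?Re_norm_ge0 // exprMn sqr_Re_norm.
by rewrite rmorphM ler_wpM2r // ler0c Re_norm_ge0.
Unshelve. all: by end_near. Qed.

(** Cauchy-Schwarz for the semidefinite form (X g, h), taken at h = X g. *)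
Lemma nonneg_sqnorm_le (c : R) g : 0 <= c ->
  selfadjoint X -> nonnegative X ->
  (forall h, sqnorm (X h) <= c ^+ 2 * sqnorm h) ->
  sqnorm (X g) <= c * rdot (X g) g.
Proof.
move=> c0 Xsa X0 Xc.
have X0r h : 0 <= rdot (X h) h by have := X0 h; rewrite lecE => /andP[].
have CS h : rdot (X g) h ^+ 2 <= rdot (X g) g * rdot (X h) h.
  apply: sqr_le_of_quad_ge0 => // r; have := X0r (g + r%:C *: h).
  rewrite linearD linearZ /= !(rdotDl, rdotDr, rdotZl, rdotZr).
  have -> : rdot (X h) g = rdot (X g) h by rewrite rdotC /rdot Xsa.
  by congr (0 <= _); ring.
have s0 := sqnorm_ge0 (X g).
have XXg : rdot (X (X g)) (X g) <= c * sqnorm (X g).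
  rewrite -(@ler_pXn2r _ 2) ?nnegrE ?mulr_ge0 //.
  apply: le_trans (rdot_CauchySchwarz _ _) _; rewrite exprMn expr2 mulrA.
  by rewrite ler_wpM2r // Xc.
apply: ler_of_sqr_self; rewrite ?mulr_ge0 //.
by apply: le_trans (CS _) _; rewrite [c * _]mulrC -mulrA ler_wpM2l.
Qed.

End BoundedNonneg.

(** * The extension of B f |-> T f to a nonnegative operator *)

Section Construction.
Variables (R : realType) (H K : hilbertType R) (T B : linop H K) (lambda : R).
Hypothesis lambda_ge0 : 0 <= lambda.
Hypothesis domBT : opdom B `<=` opdom T.
Hypothesis form_real : forall f, opdom B f -> complex.Im '[T f, B f] = 0.
Hypothesis form_ge0 : forall f, opdom B f -> 0 <= rdot (T f) (B f).
Hypothesis sqnorm_le_form :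
  forall f, opdom B f -> sqnorm (T f) <= lambda * rdot (T f) (B f).

(** The real part of the form t; its diagonal is that of t by [form_real]. *)
Local Notation "t[ f , g ]" := (rdot (T f) (B g)).

Let domZ a f : opdom B f -> opdom B (a *: f).
Proof. by move=> Bf; rewrite -[_ *: _]addr0; apply/opdomP/opdom0. Qed.

Let domD f g : opdom B f -> opdom B g -> opdom B (f + g).
Proof. by move=> Bf Bg; rewrite -[f]scale1r; apply: opdomP. Qed.

Let domB f g : opdom B f -> opdom B g -> opdom B (f - g).
Proof. by move=> Bf Bg; rewrite -scaleN1r; apply/domD/domZ. Qed.

Let funZ (S : linop H K) a f : opdom S f -> S (a *: f) = a *: S f.
Proof.
have S0 : S 0 = 0.
  have := opfunP 1 (opdom0 S) (opdom0 S).
  rewrite !scale1r addr0 => /(congr1 (fun u => u - S 0)).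
  by rewrite addrK subrr.
move=> Sf; rewrite -[a *: f]addr0 opfunP //; last exact: opdom0.
by rewrite S0 addr0.
Qed.

Let funD (S : linop H K) f g : opdom S f -> opdom S g -> S (f + g) = S f + S g.
Proof. by move=> Sf Sg; rewrite -{1}[f]scale1r opfunP // scale1r. Qed.

Let funB (S : linop H K) f g : opdom S f -> opdom S g -> S (f - g) = S f - S g.
Proof.
by move=> Sf Sg; rewrite addrC -scaleN1r opfunP // scaleN1r addrC.
Qed.

Let TZ a f : opdom B f -> T (a *: f) = a *: T f.
Proof. by move=> /domBT; exact: funZ. Qed.
Let TD f g : opdom B f -> opdom B g -> T (f + g) = T f + T g.
Proof. by move=> /domBT Bf /domBT; exact: funD. Qed.
Let TB f g : opdom B f -> opdom B g -> T (f - g) = T f - T g.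
Proof. by move=> /domBT Bf /domBT; exact: funB. Qed.

Lemma formC f g : opdom B f -> opdom B g -> t[f, g] = t[g, f].
Proof.
move=> Bf Bg; rewrite /rdot.
rewrite (@inner_hermitian_of_real_diag _ _ _ (opdom B) T B) //.
- by rewrite ReJ.
- exact: opdomP.
- by move=> a x y /domBT Tx /domBT Ty; exact: opfunP.
- exact: opfunP.
Qed.

(** [approx h f d] : the class of f in the completion E of dom B for t is at
    distance at most sqrt d from J^* h, where J : E -> K is induced by T; indeed
    (h, T g) - t(f, g) is the E-inner product of J^* h - f with g.  Taking real
    parts loses nothing, since g may be multiplied by any unit scalar. *)
Definition approx (h : K) (f : H) (d : R) :=
  opdom B f /\
  forall g, opdom B g -> (rdot h (T g) - t[f, g]) ^+ 2 <= d * t[g, g].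

Lemma approx_exists h d : 0 < d -> exists f, approx h f d.
Proof.
move=> d0; pose Q f := 2 * rdot h (T f) - t[f, f].
pose E := [set Q f | f in opdom B].
have QE f : opdom B f -> Q f <= lambda * sqnorm h.
  move=> Bf; rewrite lerBlDr; apply: ler_double_of_sqr; rewrite ?form_ge0 //.
    by rewrite mulr_ge0 ?sqnorm_ge0.
  apply: le_trans (rdot_CauchySchwarz _ _) _.
  by rewrite [lambda * _]mulrC -mulrA ler_wpM2l ?sqnorm_ge0 ?sqnorm_le_form.
have Esup : has_sup E.
  split; first by exists (Q 0), 0 => //; exact: opdom0.
  by exists (lambda * sqnorm h) => _ [f Bf <-]; exact: QE.
(* f maximizes Q up to d; comparing Q f with Q (f - r g) for all real r gives
   the bound. *)
have [_ [f Bf <-] Qf] := sup_adherent d0 Esup.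
exists f; split=> // g Bg.
apply: sqr_le_of_quad_ge0 (form_ge0 Bg) _ => r.
have Bfg : opdom B (f + (- r)%:C *: g) by apply/domD/domZ.
have : Q (f + (- r)%:C *: g) <= sup E.
  by apply: ub_le_sup; [case: Esup|exists (f + (- r)%:C *: g)].
rewrite /Q TD ?TZ //; last exact: domZ.
rewrite (@funD B) ?(@funZ B) //; last exact: domZ.
rewrite !(rdotDl, rdotDr, rdotZl, rdotZr) (formC Bg Bf).
by move: Qf; rewrite /Q => Qf Qfg; lra.
Qed.

(** The factor 2 comes from bounding the square of a sum of two distances. *)
Lemma approx_lin a h h' f f' d d' :
  approx h f d -> approx h' f' d' ->
  approx (a *: h + h') (a *: f + f')
    (2 * ((complex.Re a ^+ 2 + complex.Im a ^+ 2) * d + d')).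
Proof.
move=> [Bf hf] [Bf' hf']; split=> [|g Bg]; first exact: opdomP.
have Bag : opdom B (a^* *: g) by exact: domZ.
have tag : t[a^* *: g, a^* *: g] =
    (complex.Re a ^+ 2 + complex.Im a ^+ 2) * t[g, g].
  by rewrite TZ // funZ // rdotZZ ReJ ImJ sqrrN.
(* The scalar a is moved onto g, where it multiplies t(g, g) by |a|^2. *)
have := hf _ Bag; rewrite tag TZ // (@funZ B) // -!rdot_adj => u_le.
have := hf' _ Bg; rewrite TD ?TZ //; last exact: domZ.
rewrite !rdotDl; move: u_le.
set u := rdot (a *: h) _ - _; set v := rdot h' _ - _ => u_le v_le.
rewrite (_ : _ + _ - _ = u + v); last by rewrite /u /v; ring.
have := sqr_ge0 (u - v); move: u_le v_le.
set m := _ + _ ^+ 2; nra.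
Qed.

Lemma approx_dist h f f' d d' : 0 <= d -> 0 <= d' ->
  approx h f d -> approx h f' d' ->
  sqnorm (T f - T f') <= lambda * (2 * (d + d')).
Proof.
move=> d0 d'0 [Bf hf] [Bf' hf'].
have Bg := domB Bf Bf'; rewrite -TB //.
apply: le_trans (sqnorm_le_form Bg) _; apply: ler_wpM2l => //.
have t0 := form_ge0 Bg.
apply: ler_of_sqr_self => //; first by nra.
have := hf _ Bg; have := hf' _ Bg.
set u := rdot h _ - _; set v := rdot h _ - _ => u_le v_le.
have tE : t[f - f', f - f'] = u - v.
  by rewrite /u /v {1}TB // rdotBl; ring.
by rewrite {1}tE; have := sqr_ge0 (u + v); nra.
Qed.

(** [ext_graph h k] : k = J J^* h, that is, k is the limit of the vectors T f
    for f converging to J^* h in E. *)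
Definition ext_graph (h k : K) :=
  forall d, 0 < d -> exists2 f, approx h f d & sqnorm (T f - k) <= d.

Lemma ext_graph_fun h k k' : ext_graph h k -> ext_graph h k' -> k = k'.
Proof.
move=> hk hk'; apply/subr0_eq/sqnorm_eq0/eqP; rewrite eq_le sqnorm_ge0 andbT.
have c0 : 0 <= 6 + 16 * lambda by have := lambda_ge0; lra.
apply: (ler_of_ler_small c0) => e e0 _.
have [f hf fk] := hk e e0; have [f' hf' fk'] := hk' e e0.
have := approx_dist (ltW e0) (ltW e0) hf hf'.
rewrite add0r.
rewrite (_ : k - k' = (k - T f) + ((T f - T f') + (T f' - k'))); last first.
  by rewrite !addrA !subrK.
have := sqnormD_le (k - T f) ((T f - T f') + (T f' - k')).
have := sqnormD_le (T f - T f') (T f' - k').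
rewrite (sqnormBC k); nra.
Qed.

Lemma ext_graph_lin a h h' k k' :
  ext_graph h k -> ext_graph h' k' -> ext_graph (a *: h + h') (a *: k + k').
Proof.
move=> hk hk' d d0; pose m := complex.Re a ^+ 2 + complex.Im a ^+ 2.
have m0 : 0 <= m by rewrite addr_ge0 ?sqr_ge0.
have c0 : 0 < 2 * (m + 1) by lra.
pose e := d / (2 * (m + 1)).
have e0 : 0 < e by rewrite divr_gt0.
have dE : d = 2 * (m * e + e).
  by rewrite /e; field; rewrite gt_eqF //; lra.
have [f hf fk] := hk e e0; have [f' hf' fk'] := hk' e e0.
exists (a *: f + f'); first by rewrite dE; exact: approx_lin.
case: hf hf' => [Bf _] [Bf' _].
rewrite TD ?TZ //; last exact: domZ.
rewrite (_ : _ - _ = a *: (T f - k) + (T f' - k')); last first.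
  by rewrite scalerBr opprD addrACA.
apply: le_trans (sqnormD_le _ _) _; rewrite sqnormZ -/m dE.
by rewrite ler_wpM2l // lerD // ler_wpM2l.
Qed.

Lemma ext_graph_total h : exists k, ext_graph h k.
Proof.
have /choice [F hF] (n : nat) : exists f, approx h f n.+1%:R^-1.
  by apply: approx_exists; rewrite invr_gt0.
pose u n := T (F n).
have small (d : R) : 0 < d -> \forall n \near \oo, n.+1%:R^-1 < d.
  by move=> d0; exact: (near_infty_natSinv_lt (PosNum d0)).
have dist n m : sqnorm (u n - u m) <= lambda * (2 * (n.+1%:R^-1 + m.+1%:R^-1)).
  by apply: approx_dist (hF n) (hF m); rewrite invr_ge0.
have ucvg : cvg (u @ \oo).
  apply/cauchy_cvgP/cauchy_exP => e; case: e => e e'.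
  rewrite ltcE /= => /andP[/eqP -> e0].
  (* |u n - u N|^2 <= 4 lambda c once n, N have 1/(n+1), 1/(N+1) < c; the + 1
     allows lambda = 0. *)
  have c0 : 0 < e ^+ 2 / (4 * lambda + 1).
    by rewrite divr_gt0 ?exprn_gt0 //; have := lambda_ge0; lra.
  have [N _ hN] := small _ c0.
  exists (u N), N => // n /= Nn; rewrite -ball_normE /= norm_lt ?ltW //.
  have := hN _ (leqnn N); have := hN _ Nn.
  rewrite /= !ltr_pdivlMr; last 2 first.
  - by have := lambda_ge0; lra.
  - by have := lambda_ge0; lra.
  move=> n_small N_small; apply: le_lt_trans (dist _ _) _.
  have : 0 < n.+1%:R^-1 :> R by rewrite invr_gt0.
  have : 0 < N.+1%:R^-1 :> R by rewrite invr_gt0.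
  move: n_small N_small; set x := n.+1%:R^-1; set y := N.+1%:R^-1; nra.
exists (lim (u @ \oo)) => d d0.
have d1 : 0 < (Num.sqrt d)%:C by rewrite ltcR sqrtr_gt0.
have [n []] := filter_ex (filterI (small d d0) (cvgr_dist_lt _ _ ucvg _ d1)).
move=> nd; rewrite norm_lt ?sqrtr_ge0 // sqr_sqrtr ?ltW // => ud.
exists (F n); last by rewrite sqnormBC ltW.
have [BF hFn] := hF n; split=> // g Bg; apply: le_trans (hFn g Bg) _.
by rewrite ler_wpM2r ?form_ge0 // ltW.
Qed.

Lemma ext_graph_ran f : opdom B f -> ext_graph (B f) (T f).
Proof.
move=> Bf d d0; exists f; last by rewrite subrr /sqnorm /rdot linear0l ltW.
split=> // g Bg; rewrite rdotC (formC Bg Bf) subrr expr0n /=.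
by rewrite mulr_ge0 ?form_ge0 // ltW.
Qed.

(** The approximating f may be taken bounded in E: t(f, f) tends to
    |J^* h|^2 = (k, h). *)
Lemma ext_graph_form_bounded h k : ext_graph h k ->
  exists2 M, 0 <= M & forall e, 0 < e -> e <= 1 ->
    exists f, [/\ approx h f (e ^+ 2), sqnorm (T f - k) <= e ^+ 2
                 & t[f, f] <= M].
Proof.
move=> hk; have h0 := sqnorm_ge0 h.
exists (2 + 4 * rdot k h ^+ 2 + 4 * sqnorm h) => [|e e0 e1].
  by have := sqr_ge0 (rdot k h); lra.
have [f hf fk] := hk _ (exprn_gt0 2 e0); exists f; split=> //.
have [Bf /(_ f Bf)] := hf.
have t0 := form_ge0 Bf.
have := rdot_CauchySchwarz (T f - k) h; rewrite rdotBl (rdotC h).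
have e21 : e ^+ 2 <= 1 by rewrite expr_le1 // ltW.
move: (rdot k h) (rdot (T f) h) t[f, f] (sqnorm h) t0 h0 => p w t s t0 s0 pw wt.
have {}pw : (w - p) ^+ 2 <= s.
  by apply: le_trans pw _; have := sqnorm_ge0 (T f - k); nra.
have {}wt : (w - t) ^+ 2 <= t by nra.
rewrite leNgt; apply/negP => lt_t.
have := sqr_ge0 (w - 2 * p); have := sqr_ge0 (t - 2 * w); nra.
Qed.

(** The relation (k, h) = |J^* h|^2 = lim t(f, f) in quantitative form. *)
Lemma ext_graph_form_approx h k : ext_graph h k ->
  exists2 C, 0 <= C & forall e, 0 < e -> e <= 1 ->
    exists f, [/\ opdom B f, sqnorm (T f - k) <= e ^+ 2,
      t[f, f] <= rdot k h + e * C & `|complex.Im '[k, h]| <= e * C].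
Proof.
move=> /ext_graph_form_bounded [M M0 hk]; have h0 := sqnorm_ge0 h.
pose C := 2 * (sqnorm h + M); have C0 : 0 <= C by rewrite /C; lra.
exists (C + 1) => [|e e0 e1]; first by lra.
have [f [[Bf hf] fk tM]] := hk e e0 e1; have t0 := form_ge0 Bf.
have e20 := sqr_ge0 e.
have CS h' : sqnorm h' = sqnorm h ->
    rdot (T f - k) h' ^+ 2 <= e ^+ 2 * sqnorm h.
  move=> <-; apply: le_trans (rdot_CauchySchwarz _ _) _.
  by rewrite ler_wpM2r ?sqnorm_ge0.
exists f; split=> //.
  rewrite -lerBlDl; apply: ler_of_sqr_scaled (ltW e0) C0 _.
  have := hf f Bf; have := CS h erefl; rewrite rdotBl (rdotC h) /C.
  have := sqr_ge0 (rdot (T f) h - rdot k h - (t[f, f] - rdot (T f) h)).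
  nra.
(* Im (k, h) is compared with Im (T f, h), and the latter is small by [approx]
   at g = i f, because t(f, i f) has real part Im t(f, f) = 0. *)
have ih : sqnorm ('i *: h) = sqnorm h.
  by rewrite sqnormZ /= expr0n expr1n add0r mul1r.
have Bif : opdom B ('i *: f) by exact: domZ.
have tii : t['i *: f, 'i *: f] = t[f, f].
  by rewrite TZ // funZ // rdotZZ /= expr0n expr1n add0r mul1r.
have := hf _ Bif; have := CS _ ih; rewrite tii rdotBl -!Im_inner.
rewrite TZ // (@funZ B) // -!Im_inner form_real // subr0.
rewrite (innerC h) ImJ sqrrN => le1 le2.
have lem x : x ^+ 2 <= e ^+ 2 * C -> x <= e * (C + 1).
  exact: ler_of_sqr_scaled (ltW e0) C0.
rewrite ler_norml lerNl; apply/andP; split; apply: lem; rewrite ?sqrrN /C;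
move: le1 le2; set a := complex.Im _; set b := complex.Im _ => le1 le2;
have := sqr_ge0 (a - 2 * b); have := sqr_ge0 (2 * a - b); nra.
Qed.

Lemma ext_graph_ge0 h k : ext_graph h k -> 0 <= '[k, h].
Proof.
move=> /ext_graph_form_approx [C C0 hk]; rewrite lecE /= -normr_eq0.
apply/andP; split.
  rewrite eq_le normr_ge0 andbT; apply: (ler_of_ler_small C0) => e e0 e1.
  by have [f [_ _ _]] := hk e e0 e1; rewrite add0r.
apply: (ler_of_ler_small C0) => e e0 e1.
have [f [Bf _ le _]] := hk e e0 e1; exact: le_trans (form_ge0 Bf) le.
Qed.

Lemma ext_graph_sqnorm_le h k : ext_graph h k -> sqnorm k <= lambda * rdot k h.
Proof.
move=> /ext_graph_form_approx [C C0 hk]; have k0 := sqnorm_ge0 k.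
have c0 : 0 <= lambda * C + 2 * (sqnorm k + 1).
  by have := mulr_ge0 lambda_ge0 C0; lra.
apply: (ler_of_ler_small c0) => e e0 e1.
have [f [Bf fk le _]] := hk e e0 e1.
have : rdot (k - T f) k <= e * (sqnorm k + 1).
  apply: ler_of_sqr_scaled (ltW e0) k0 _.
  apply: le_trans (rdot_CauchySchwarz _ _) _.
  by rewrite ler_wpM2r ?sqnorm_ge0 // sqnormBC.
have := sqnorm_ge0 (T f - k); rewrite sqnormD sqnormN rdotNr.
rewrite rdotBl -/(sqnorm k).
have := sqnorm_le_form Bf; have := ler_wpM2l lambda_ge0 le; lra.
Qed.

Lemma extension_exists : exists X : {linear K -> K},
  [/\ bounded_nonneg X, opnorm X <= lambda, op_subset (comp_op X B) T &
      range X `<=` closure (opran T)].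
Proof.
have [F hF] := choice ext_graph_total.
have Flin : linear F.
  by move=> a x y; apply: ext_graph_fun (hF _) (ext_graph_lin a (hF x) (hF y)).
pose FL := GRing.isLinear.Build _ _ _ _ F Flin.
pose X : {linear K -> K} := HB.pack F FL.
have Xbound g : sqnorm (X g) <= lambda ^+ 2 * sqnorm g.
  have s0 := sqnorm_ge0 (X g); have s0' := sqnorm_ge0 g.
  have := ext_graph_sqnorm_le (hF g); rewrite -/(X g) => le1.
  apply: ler_of_sqr_self; rewrite ?mulr_ge0 ?sqr_ge0 //.
  have : sqnorm (X g) ^+ 2 <= (lambda * rdot (X g) g) ^+ 2.
    by rewrite ler_pXn2r ?nnegrE // (le_trans s0).
  move/le_trans; apply; rewrite exprMn -[X in _ <= X]mulrA [sqnorm g * _]mulrC.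
  by rewrite ler_wpM2l ?sqr_ge0 // rdot_CauchySchwarz.
exists X; split.
- split.
  + exact: bounded_near_of_sqnorm_le lambda_ge0 Xbound.
  + move=> g h; rewrite [RHS]innerC.
    apply: (@inner_hermitian_of_real_diag _ _ _ setT X id) => //.
      by move=> a x y _ _; rewrite linearP.
    by move=> x _; apply/ger0_Im/ext_graph_ge0/hF.
  + by move=> g; apply/ext_graph_ge0/hF.
- exact: opnorm_le.
- split; first exact: domBT.
  by move=> f Bf /=; apply: ext_graph_fun (hF _) (ext_graph_ran Bf).
- move=> _ [h _ <-] V /nbhs_ballP [[e e'] /=].
  rewrite ltcE /= => /andP[/eqP -> e0] eV.
  have e20 : 0 < e ^+ 2 / 2 by rewrite divr_gt0 ?exprn_gt0.
  have [f [Bf _] fk] := hF h _ e20.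
  exists (T f); split; first by exists f => //; exact: domBT.
  apply: eV; rewrite -ball_normE /= norm_lt ?ltW // sqnormBC.
  apply: le_lt_trans fk _; rewrite ltr_pdivrMr // ltr_pMr ?exprn_gt0 //.
  by rewrite ltr1n.
Qed.

End Construction.

(** * The equivalence *)

Theorem theorem2p1 (R : realType) (H K : hilbertType R) (T B : linop H K)
    (Tclosed : closed_op T) (Tdense : densely_defined T)
    (Bclosed : closed_op B) (Bdense : densely_defined B)
    (lambda : R) (lambda_ge0 : 0 <= lambda) :
  ((opdom B `<=` opdom T /\
    forall f : H, opdom B f -> `|T f| ^+ 2 <= lambda%:C * '[T f, B f])
   <->
   (exists X : {linear K -> K},
      [/\ bounded_nonneg X, opnorm X <= lambda & op_subset (comp_op X B) T]))
  /\
  ((exists X : {linear K -> K},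
      [/\ bounded_nonneg X, opnorm X <= lambda & op_subset (comp_op X B) T]) ->
   exists X : {linear K -> K},
     [/\ bounded_nonneg X, opnorm X <= lambda, op_subset (comp_op X B) T &
         range X `<=` closure (opran T)]).
Proof.
set form_bound := (X in (X <-> _) /\ _); set extension := (X in (_ <-> X) /\ _).
have nec : extension -> form_bound.
  move=> [X [[Xb Xsa X0] Xl [BT XB]]]; split=> // f Bf; rewrite -XB //=.
  have Xl2 g : sqnorm (X g) <= lambda ^+ 2 * sqnorm g.
    apply: le_trans (sqnorm_le_opnorm g Xb) _; rewrite ler_wpM2r ?sqnorm_ge0 //.
    by rewrite ler_pXn2r ?nnegrE ?opnorm_ge0.
  have := nonneg_sqnorm_le (B f) lambda_ge0 Xsa X0 Xl2.
  have -> : '[X (B f), B f] = (rdot (X (B f)) (B f))%:C.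
    by rewrite /rdot RRe_real // ger0_real.
  by rewrite sqr_norm_inner inner_norm_real -rmorphM lecR.
have suf : form_bound ->
    exists X : {linear K -> K},
      [/\ bounded_nonneg X, opnorm X <= lambda, op_subset (comp_op X B) T &
          range X `<=` closure (opran T)].
  move=> [BT le].
  have le_re f : opdom B f -> sqnorm (T f) <= lambda * rdot (T f) (B f) /\
      lambda * complex.Im '[T f, B f] = 0.
    move=> /le; rewrite sqr_norm_inner inner_norm_real -innerZl lecE.
    by rewrite -/(rdot _ _) !Im_inner !rdotZl => /andP[/eqP].
  (* For lambda = 0 the hypothesis does not bound (T f, B f) directly, but it
     forces T f = 0. *)
  have [l0|ln0] := eqVneq lambda 0.
    have T0 f : opdom B f -> T f = 0.
      move=> /le_re [+ _]; rewrite l0 mul0r => T0.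
      by apply/sqnorm_eq0/eqP; rewrite eq_le T0 sqnorm_ge0.
    apply: extension_exists => // f Bf; rewrite T0 //.
    + by rewrite linear0l.
    + by rewrite /rdot linear0l.
    + by rewrite l0 mul0r /sqnorm /rdot linear0l.
  have l_gt0 : 0 < lambda by rewrite lt_def ln0.
  apply: extension_exists => // f /le_re [le1 Im0] //.
    by move/eqP: Im0; rewrite mulf_eq0 (negbTE ln0) => /eqP.
  by rewrite -(pmulr_rge0 _ l_gt0) (le_trans _ le1) ?sqnorm_ge0.
split; last by move/nec/suf.
by split=> [/suf [X [? ? ? _]]|]; [exists X|exact: nec].
Qed.
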